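(* Let $(\mathcal{D},\prec_\vdash,\prec_\dashv,\succ_\vdash,\succ_\dashv)$ be a quadri-dendriform algebra. For all $x,y\in\mathcal{D}$ define $$x\vdash y=x\prec_\vdash y+x\succ_\vdash y,\qquad x\dashv y=x\prec_\dashv y+x\succ_\dashv y.$$ Then $(\mathcal{D},\vdash,\dashv)$ is a di-associative algebra.
   Context: Throughout, $\mathbb{K}$ is a field of characteristic zero; all vector spaces and (multi)linear maps are over $\mathbb{K}$, and all binary operations are bilinear. A di-associative algebra is a vector space $A$ with two binary operations $\vdash,\dashv:A\otimes A\to A$ such that for all $x,y,z\in A$: $(x\dashv y)\dashv z=x\dashv(y\vdash z)$, $(x\dashv y)\dashv z=x\dashv(y\dashv z)$, $(x\vdash y)\dashv z=x\vdash(y\dashv z)$, $(x\dashv y)\vdash z=x\vdash(y\vdash z)$, $(x\vdash y)\vdash z=x\vdash(y\vdash z)$. A quadri-dendriform algebra is a vector space $\mathcal{D}$ with four binary operations $\prec_\vdash,\prec_\dashv,\succ_\vdash,\succ_\dashv$ such that for all $x,y,z\in\mathcal{D}$: (1) $(x\prec_\vdash y)\prec_\vdash z=(x\prec_\dashv y)\prec_\vdash z=x\prec_\vdash(y\prec_\vdash z+y\succ_\vdash z)$; (2) $(x\succ_\vdash y)\prec_\vdash z=(x\succ_\dashv y)\prec_\vdash z=x\succ_\vdash(y\prec_\vdash z)$; (3) $x\succ_\vdash(y\succ_\vdash z)=(x\prec_\vdash y+x\succ_\vdash y)\succ_\vdash z=(x\prec_\dashv y+x\succ_\dashv y)\succ_\vdash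 z=(x\prec_\vdash y+x\succ_\dashv y)\succ_\vdash z=(x\prec_\dashv y+x\succ_\vdash y)\succ_\vdash z$; (4) $(x\prec_\vdash y)\prec_\dashv z=x\prec_\vdash(y\prec_\dashv z+y\succ_\dashv z)$; (5) $(x\succ_\vdash y)\prec_\dashv z=x\succ_\vdash(y\prec_\dashv z)$; (6) $x\succ_\vdash(y\succ_\dashv z)=(x\prec_\vdash y+x\succ_\vdash y)\succ_\dashv z$; (7) $(x\prec_\dashv y)\prec_\dashv z=x\prec_\dashv(y\prec_\vdash z+y\succ_\vdash z)=x\prec_\dashv(y\prec_\dashv z+y\succ_\dashv z)=x\prec_\dashv(y\prec_\vdash z+y\succ_\dashv z)=x\prec_\dashv(y\prec_\dashv z+y\succ_\vdash z)$; (8) $(x\succ_\dashv y)\prec_\dashv z=x\succ_\dashv(y\prec_\vdash z)=x\succ_\dashv(y\prec_\dashv z)$; (9) $x\succ_\dashv(y\succ_\vdash z)=x\succ_\dashv(y\succ_\dashv z)=(x\prec_\dashv y+x\succ_\dashv y)\succ_\dashv z$. *)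

(* Defs.v *)
From mathcomp Require Import all_boot all_order all_algebra.

Set Implicit Arguments.
Unset Strict Implicit.
Unset Printing Implicit Defensive.

Import GRing.Theory.
Local Open Scope ring_scope.

Notation bilinear_op f := (bilinear_for *:%R *:%R f).

Section DiAssociative.
Context (K : fieldType) (A : lmodType K) (vd dv : A -> A -> A).

Local Notation "x |> y" := (vd x y) (at level 40, left associativity).
Local Notation "x <| y" := (dv x y) (at level 40, left associativity).

(* x |> y stands for x \vdash y, and x <| y for x \dashv y. *)
Record is_diassociative : Prop := IsDiAssociative {
  vdash_bilinear : bilinear_op vd;
  dashv_bilinear : bilinear_op dv;
  dias1 : forall x y z, (x <| y) <| z = x <| (y |> z);
  dias2 : forall x y z, (x <| y) <| z = x <| (y <| z);
  dias3 : forall x y z, (x |> y) <| z = x |> (y <| z);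
  dias4 : forall x y z, (x <| y) |> z = x |> (y |> z);
  dias5 : forall x y z, (x |> y) |> z = x |> (y |> z)
}.

End DiAssociative.

Section QuadriDendriform.
Context (K : fieldType) (D : lmodType K).
Context (prec_vd prec_dv succ_vd succ_dv : D -> D -> D).

Local Notation "x <|- y" := (prec_vd x y) (at level 40, left associativity).
Local Notation "x <-| y" := (prec_dv x y) (at level 40, left associativity).
Local Notation "x >|- y" := (succ_vd x y) (at level 40, left associativity).
Local Notation "x >-| y" := (succ_dv x y) (at level 40, left associativity).

(* < stands for \prec and > for \succ, with |- and -| for the subscripts
   \vdash and \dashv. A chain of equalities a = b = c is split into equations
   sharing one of its members. *)
Record is_quadri_dendriform : Prop := IsQuadriDendriform {
  prec_vd_bilinear : bilinear_op prec_vd;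
  prec_dv_bilinear : bilinear_op prec_dv;
  succ_vd_bilinear : bilinear_op succ_vd;
  succ_dv_bilinear : bilinear_op succ_dv;
  quadri1 : forall x y z,
    (x <|- y) <|- z = x <|- (y <|- z + y >|- z) /\
    (x <-| y) <|- z = x <|- (y <|- z + y >|- z);
  quadri2 : forall x y z,
    (x >|- y) <|- z = x >|- (y <|- z) /\
    (x >-| y) <|- z = x >|- (y <|- z);
  quadri3 : forall x y z,
    [/\ x >|- (y >|- z) = (x <|- y + x >|- y) >|- z,
        x >|- (y >|- z) = (x <-| y + x >-| y) >|- z,
        x >|- (y >|- z) = (x <|- y + x >-| y) >|- z &
        x >|- (y >|- z) = (x <-| y + x >|- y) >|- z];
  quadri4 : forall x y z,
    (x <|- y) <-| z = x <|- (y <-| z + y >-| z);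
  quadri5 : forall x y z,
    (x >|- y) <-| z = x >|- (y <-| z);
  quadri6 : forall x y z,
    x >|- (y >-| z) = (x <|- y + x >|- y) >-| z;
  quadri7 : forall x y z,
    [/\ (x <-| y) <-| z = x <-| (y <|- z + y >|- z),
        (x <-| y) <-| z = x <-| (y <-| z + y >-| z),
        (x <-| y) <-| z = x <-| (y <|- z + y >-| z) &
        (x <-| y) <-| z = x <-| (y <-| z + y >|- z)];
  quadri8 : forall x y z,
    (x >-| y) <-| z = x >-| (y <|- z) /\
    (x >-| y) <-| z = x >-| (y <-| z);
  quadri9 : forall x y z,
    x >-| (y >|- z) = (x <-| y + x >-| y) >-| z /\
    x >-| (y >-| z) = (x <-| y + x >-| y) >-| z
}.

End QuadriDendriform.

(* Main.v *)
Require Import Defs.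
From mathcomp Require Import all_boot all_order all_algebra.

Import GRing.Theory.
Local Open Scope ring_scope.

(** The sums of the prec and succ operations are associative products cut into
    two pieces, as in a dendriform algebra. Each di-associative identity has
    the form (x * y) . z = x : (y o z). Its left side expands into three terms,
    (x prec y) prec z, (x succ y) prec z and (x * y) succ z, and its right side
    into x prec (y o z), x succ (y prec z) and x succ (y succ z); the
    quadri-dendriform axioms match these terms one by one. This expansion,
    [splitting_assoc], does not depend on which of the two products occurs at
    each of the four places, so the five identities follow by choosing the
    three axioms each time:
    - (x -| y) -| z = x -| (y |- z) and (x -| y) -| z = x -| (y -| z) from
      [quadri7], [quadri8], [quadri9];
    - (x |- y) -| z = x |- (y -| z) from [quadri4], [quadri5], [quadri6];
    - (x -| y) |- z = x |- (y |- z) and (x |- y) |- z = x |- (y |- z) from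
      [quadri1], [quadri2], [quadri3]. *)

Section BilinearOperations.
Context {K : fieldType} {D : lmodType K}.
Implicit Types f g : D -> D -> D.

Lemma bilinear_op_addl {f} : bilinear_op f ->
  forall x y z, f (x + y) z = f x z + f y z.
Proof. by case=> fl _ x y z; have := fl z 1 x y; rewrite /= !scale1r. Qed.

Lemma bilinear_op_addr {f} : bilinear_op f ->
  forall x y z, f x (y + z) = f x y + f x z.
Proof. by case=> _ fr x y z; have := fr x 1 y z; rewrite /= !scale1r. Qed.

Lemma bilinear_op_add f g : bilinear_op f -> bilinear_op g ->
  bilinear_op (fun x y => f x y + g x y).
Proof.
case=> [fl fr] [gl gr]; split=> u a x y /=.
  by rewrite (fl u a x y) (gl u a x y) /= scalerDr addrACA.
by rewrite (fr u a x y) (gr u a x y) /= scalerDr addrACA.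
Qed.

(** The outer products on the two sides split as [p1 + s1] and [p2 + s2], the
    inner ones as [a + b] and [c + d]. All eight pieces are kept independent
    because the di-associative identities mix the two products. Only [p1] and
    [s2] get expanded on a sum: the inner product stays whole as an argument
    of [s1] and of [p2], as in the dendriform axioms. *)
Lemma splitting_assoc {p1 s1 a b p2 s2 c d : D -> D -> D} {x y z : D} :
    bilinear_op p1 -> bilinear_op s2 ->
    p1 (a x y) z = p2 x (c y z + d y z) ->
    p1 (b x y) z = s2 x (c y z) ->
    s1 (a x y + b x y) z = s2 x (d y z) ->
  p1 (a x y + b x y) z + s1 (a x y + b x y) z =
  p2 x (c y z + d y z) + s2 x (c y z + d y z).
Proof.
move=> p1B s2B eq_pp eq_sp eq_s.
by rewrite (bilinear_op_addl p1B) (bilinear_op_addr s2B) eq_pp eq_sp eq_s addrA.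
Qed.

End BilinearOperations.

Theorem proposition2p6 (K : fieldType) (charK : has_pchar0 K)
    (D : lmodType K) (prec_vd prec_dv succ_vd succ_dv : D -> D -> D)
    (quadriD : is_quadri_dendriform prec_vd prec_dv succ_vd succ_dv) :
  is_diassociative (fun x y => prec_vd x y + succ_vd x y)
                   (fun x y => prec_dv x y + succ_dv x y).
Proof.
case: quadriD => pvB pdB svB sdB q1 q2 q3 q4 q5 q6 q7 q8 q9.
split; [exact: bilinear_op_add | exact: bilinear_op_add | | | | |] => x y z.
- have [pp _ _ _] := q7 x y z; have [sp _] := q8 x y z.
  by have [ss _] := q9 x y z; exact: splitting_assoc pdB sdB pp sp (esym ss).
- have [_ pp _ _] := q7 x y z; have [_ sp] := q8 x y z.
  by have [_ ss] := q9 x y z; exact: splitting_assoc pdB sdB pp sp (esym ss).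
- exact: splitting_assoc pdB svB (q4 x y z) (q5 x y z) (esym (q6 x y z)).
- have [_ pp] := q1 x y z; have [_ sp] := q2 x y z.
  by have [_ ss _ _] := q3 x y z; exact: splitting_assoc pvB svB pp sp (esym ss).
- have [pp _] := q1 x y z; have [sp _] := q2 x y z.
  by have [ss _ _ _] := q3 x y z; exact: splitting_assoc pvB svB pp sp (esym ss).
Qed.
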